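(* Suppose $d\geq 3$ and $p\in(p'_c,1-p_c^{\text{site}})$, where $p_c^{\text{site}}=p_c^{\text{site}}(d)$ is the critical probability of independent site percolation on $\mathbb{Z}^d$. Let $\tilde\lambda=\tilde\lambda(d,p)>0$ be a constant such that for every $\lambda\in(0,\tilde\lambda)$, in first passage percolation in a hostile environment on $\mathbb{Z}^d$ with parameters $p$ and $\lambda$, $FPP_1$ occupies a positive density of sites with positive probability (such a constant exists). If $\lambda\in(0,\tilde\lambda)$, then with positive probability $FPP_1$ and $FPP_\lambda$ coexist and both occupy a positive density of sites.
   Context: First passage percolation in a hostile environment (FPPHE) on $\mathbb{Z}^d$ (nearest-neighbour graph with edge set $E$) with parameters $p\in(0,1)$, $\lambda>0$ is the following process. Each site other than the origin independently hosts a seed with probability $p$. Independently, let $\{t_e\}_{e\in E}$ be i.i.d. exponential random variables of rate $1$ and $\{t^\lambda_e\}_{e\in E}$ i.i.d. exponential random variables of rate $\lambda$. At time $0$ all seeds are inactive (dormant) and $FPP_1$ occupies only the origin. If a site $x$ is first occupied by $FPP_1$ at time $t$ and $y$ is a neighbour of $x$ joined by the edge $e$, then $FPP_1$ attempts to occupy $y$ at time $t+t_e$: if $y$ is already occupied by $FPP_1$ or $FPP_\lambda$, nothing happens; if $y$ is a still inactive seed, then $y$ is activated, meaning that $y$ becomes occupied by $FPP_\lambda$ at time $t+t_e$; otherwise $y$ becomes occupied by $FPP_1$ at time $t+t_e$. If $x$ is first occupied by $FPP_\lambda$ at time $t$, the rule is the same with $t^\lambda_e$ in place of $t_e$ and with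 $FPP_\lambda$ occupying $y$ if $y$ is not already occupied (whether $y$ is an inactive seed or a non-seed). A site occupied by a process remains occupied by that process forever. A process survives if in the limit as time goes to infinity it occupies an infinite connected component of $\mathbb{Z}^d$ (i.e. the set of sites it eventually occupies contains an infinite connected component). $FPP_1$ and $FPP_\lambda$ coexist if both survive. A process occupies a positive density of sites if the set $S$ of sites it occupies in the limit $t\to\infty$ satisfies $\liminf_{n\to\infty}|S\cap[-n,n]^d|/(2n+1)^d>0$. Filled seeds: after placing seeds with density $p$, the filled seeds are the seeds together with all sites that are disconnected from infinity by seeds. Let $\{o\xrightarrow{f}\infty\}$ be the event that a neighbour of the origin is contained in an infinite connected component of filled seeds, let $\mathbb{P}_{1-p}$ be the law induced by placing seeds with density $p$, and set $p'_c=\sup\{p\in[0,1]:\mathbb{P}_{1-p}(o\xrightarrow{f}\infty)=0\}$. *)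

(* Defs.v *)
From HB Require Import structures.
From mathcomp Require Import all_boot all_order all_algebra finmap.
From mathcomp Require Import all_classical all_reals all_analysis measurable_realfun.

Set Implicit Arguments.
Unset Strict Implicit.
Unset Printing Implicit Defensive.

Import Order.TTheory GRing.Theory Num.Theory.
Local Open Scope classical_set_scope.
Local Open Scope ring_scope.

(** The lattice Z^d; its origin is [0]. *)

Definition site (d : nat) := 'rV[int]_d.

(** The pair [(x, i)] stands for the undirected edge between [x] and
    [x + e_i]; every nearest-neighbour edge is represented exactly once. *)
Definition edge (d : nat) := (site d * 'I_d)%type.

Definition joins d (e : edge d) (x y : site d) : Prop :=
  let a := e.1 in let b := e.1 + delta_mx 0 e.2 in
  (x = a /\ y = b) \/ (x = b /\ y = a).

Definition adjacent d (x y : site d) : Prop := exists e : edge d, joins e x y.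

(** [cluster A x] is the connected component of [x] in the subgraph of Z^d
    induced by [A]; it is empty when [x] is not in [A]. *)
Inductive linked d (A : set (site d)) (x : site d) : site d -> Prop :=
| linked_refl : A x -> linked A x x
| linked_step y z : linked A x y -> adjacent y z -> A z -> linked A x z.

Definition cluster d (A : set (site d)) (x : site d) : set (site d) :=
  [set y | linked A x y].

Definition box d (n : nat) : set (site d) :=
  [set x | forall i, `|x 0 i| <= n%:Z].
Arguments box d n : clear implicits.

(** This ensures that [fset_set] below is never applied to an infinite set. *)
Lemma finite_box d n : finite_set (box d n).
Proof.
pose f (g : {ffun 'I_d -> 'I_(n + n).+1}) : site d :=
  \row_i ((g i)%:Z - n%:Z).
apply: (@sub_finite_set _ _ (range f)); last exact: finite_image.
move=> x bx; exists [ffun i => inord (absz (x 0 i + n%:Z))] => //.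
apply/rowP => i; rewrite mxE ffunE.
have := bx i; rewrite ler_norml => /andP[xl xr].
have x0 : 0 <= x 0 i + n%:Z by rewrite -lerBlDr sub0r.
rewrite inordK; first by rewrite gez0_abs// addrK.
by rewrite ltnS -lez_nat gez0_abs// PoszD lerD2r.
Qed.

Definition positive_density (R : realType) d (S : set (site d)) : Prop :=
  (0 < limn_einf (fun n =>
     ((#|` fset_set (S `&` box d n)|)%:R / ((n.*2.+1)%:R ^+ d) : R)%:E))%E.

(** Mutual independence of a family [F] of classes of events. *)
Definition mutually_independent disp (T : measurableType disp) (R : realType)
    (P : probability T R) (I : choiceType) (F : I -> set (set T)) : Prop :=
  forall (J : {fset I}) (E : I -> set T), (forall i, i \in J -> F i (E i)) ->
    P (\bigcap_(i in [set` J]) E i) = (\prod_(i <- J) P (E i))%E.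

Definition events_of disp disp' (T : measurableType disp)
    (T' : measurableType disp') (X : T -> T') : set (set T) :=
  preimage_set_system setT X measurable.

Definition bernoulli_field disp (T : measurableType disp) (R : realType)
    (P : probability T R) d (q : R) (X : site d -> {RV P >-> bool}) : Prop :=
  (forall x, P [set w | X x w] = q%:E) /\
  mutually_independent P (fun x => events_of (X x)).

(** sup {q : P_q(the open cluster of the origin is infinite) = 0}.  The library
    has no infinite product measure, so P_q is given by an arbitrary realisation
    of the Bernoulli field; its law does not depend on the realisation. *)
Definition pc_site (R : realType) (d : nat) : R :=
  sup [set q : R | 0 <= q <= 1 /\
    forall disp (T : measurableType disp) (P : probability T R)
           (X : site d -> {RV P >-> bool}),
      bernoulli_field q X ->
      P [set w | infinite_set (cluster [set x | X x w] 0)] = 0%E].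

(** Seeds are placed independently with density [p] at the sites other than
    the origin, which never hosts a seed. *)
Definition seed_density disp (T : measurableType disp) (R : realType)
    (P : probability T R) d (p : R) (S : site d -> {RV P >-> bool}) : Prop :=
  (forall w, S 0 w = false) /\
  (forall x, x != 0 -> P [set w | S x w] = p%:E).

Definition seed_field disp (T : measurableType disp) (R : realType)
    (P : probability T R) d (p : R) (S : site d -> {RV P >-> bool}) : Prop :=
  seed_density p S /\ mutually_independent P (fun x => events_of (S x)).

(** A site is disconnected from infinity by the seeds when its component in the
    complement of the seeds is finite. *)
Definition filled d (S : set (site d)) : set (site d) :=
  S `|` [set x | finite_set (cluster (~` S) x)].

Definition origin_to_infinity_filled d (S : set (site d)) : Prop :=
  exists2 y, adjacent 0 y & infinite_set (cluster (filled S) y).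

(** This is p'_c = sup {p : P_{1-p}(o -f-> oo) = 0}, with the law of the seeds
    given by an arbitrary realisation as in [pc_site]. *)
Definition pc_filled (R : realType) (d : nat) : R :=
  sup [set p : R | 0 <= p <= 1 /\
    forall disp (T : measurableType disp) (P : probability T R)
           (S : site d -> {RV P >-> bool}),
      seed_field p S ->
      P [set w | origin_to_infinity_filled [set x | S x w]] = 0%E].

(** The two processes are encoded by booleans so that the type of the process
    occupying a site can be a [bool]-valued random variable. *)
Definition FPP1 : bool := false.
Definition FPPlambda : bool := true.

Definition passage (R : realType) d (t tlambda : edge d -> R) (k : bool) :
  edge d -> R := if k == FPPlambda then tlambda else t.

(** The rules of the process for fixed seeds and passage times.  [tau x] is the
    time at which [x] is first occupied ([+oo] if never) and [kind x] the
    process occupying it, meaningful when [tau x] is finite.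
    [occupied_no_later]: the attempt made from [x] through [e] at time
    [tau x + t_e] leaves [y] occupied at that time at the latest.
    [occupied_by_attempt]: a site is only occupied through such an attempt; the
    occupier is [FPPlambda] when the attempt comes from [FPPlambda] or hits a
    seed (which is then activated), and [FPP1] otherwise. *)
Record fpphe_rules (R : realType) d (seed : site d -> bool)
    (t tlambda : edge d -> R) (tau : site d -> \bar R)
    (kind : site d -> bool) : Prop := {
  nonneg_time : forall x, (0 <= tau x)%E ;
  origin_time : tau 0 = 0%E ;
  origin_kind : kind 0 = FPP1 ;
  occupied_no_later : forall x y e, joins e x y ->
    (tau y <= tau x + (passage t tlambda (kind x) e)%:E)%E ;
  occupied_by_attempt : forall y, y != 0 -> (tau y < +oo)%E ->
    exists x e, [/\ joins e x y,
      tau y = (tau x + (passage t tlambda (kind x) e)%:E)%E &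
      kind y = if (kind x == FPPlambda) || seed y then FPPlambda else FPP1]
}.

Definition fpphe_source d : choiceType := (site d + (edge d + edge d))%type.

(** First passage percolation in a hostile environment on Z^d with parameters
    [p] and [lambda], realised on the probability space [(T, P)].  Passage times
    are almost surely positive, pairwise distinct along different routes and
    not summable along any infinite self-avoiding path, so the rules determine
    [tau] and [kind] almost surely. *)
Record fpphe (R : realType) (d : nat) (p lambda : R) disp
    (T : measurableType disp) (P : probability T R) := {
  seed : site d -> {RV P >-> bool} ;
  clock1 : edge d -> {RV P >-> R} ;
  clocklambda : edge d -> {RV P >-> R} ;
  tau : site d -> {RV P >-> \bar R} ;
  kind : site d -> {RV P >-> bool} ;
  fpphe_seed : seed_density p seed ;
  fpphe_clock1 : forall e A, measurable A ->
    distribution P (clock1 e) A = exponential_prob 1 A ;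
  fpphe_clocklambda : forall e A, measurable A ->
    distribution P (clocklambda e) A = exponential_prob lambda A ;
  fpphe_independent : mutually_independent P (fun s : fpphe_source d =>
    match s with
    | inl x => events_of (seed x)
    | inr (inl e) => events_of (clock1 e)
    | inr (inr e) => events_of (clocklambda e)
    end) ;
  fpphe_dynamics : {ae P, forall w,
    fpphe_rules (seed^~ w) (clock1^~ w) (clocklambda^~ w)
                (tau^~ w) (kind^~ w)}
}.

(** The sites eventually occupied by process [k], in the realisation [w]. *)
Definition occupied (R : realType) d (p lambda : R) disp
    (T : measurableType disp) (P : probability T R)
    (X : fpphe d p lambda P) (k : bool) (w : T) : set (site d) :=
  [set x | (tau X x w < +oo)%E /\ kind X x w = k].

Definition survives (R : realType) d (p lambda : R) disp
    (T : measurableType disp) (P : probability T R)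
    (X : fpphe d p lambda P) (k : bool) (w : T) : Prop :=
  exists x, infinite_set (cluster (occupied X k w) x).

Definition coexist (R : realType) d (p lambda : R) disp
    (T : measurableType disp) (P : probability T R)
    (X : fpphe d p lambda P) (w : T) : Prop :=
  survives X FPP1 w /\ survives X FPPlambda w.

Definition occupies_positive_density (R : realType) d (p lambda : R) disp
    (T : measurableType disp) (P : probability T R)
    (X : fpphe d p lambda P) (k : bool) (w : T) : Prop :=
  positive_density R (occupied X k w).

(* Main.v *)
Require Import Defs.
From HB Require Import structures.
From mathcomp Require Import all_boot all_order all_algebra finmap.
From mathcomp Require Import all_classical all_reals all_analysis measurable_realfun.
From mathcomp Require Import zify ring lra.

(** By assumption [FPP1] has positive density with positive probability, so it
    is enough to show that, almost surely, coexistence and the positive density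
    of the other process follow from this event.

    Every site is eventually occupied, and tracing predecessors back from a site
    occupied by [FPP1] leads to the origin through sites that are occupied by
    [FPP1] and host no seed ([FPP1_linked]). The trace ends because an infinite
    one would contain arbitrarily long self-avoiding paths all of whose passage
    times are at most [eps]: there are at most [(2 d) ^ n] paths of [n] steps,
    each of them with probability at most [eps ^ n], so almost surely there are
    none when [2 d eps < 1] ([no_long_cheap_walk]). Hence the sites of [FPP1]
    form a single component. When [FPP1] has positive density this component is
    infinite, so [FPP1] survives, and the component of the origin off the seeds
    is infinite too. A filled site, being either a seed or enclosed by seeds, is
    not in it, and is therefore occupied by [FPPlambda]
    ([filled_occupied_by_lambda]).

    It remains to see that there are many filled sites. The seeds alone have
    positive density almost surely, by Chernoff's bound and the Borel-Cantelli
    lemma ([seeds_positive_density]). For survival, an infinite component of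
    filled sites exists with positive probability as [p] is above the critical
    density. Changing finitely many seeds changes finitely many filled sites, and
    does not affect the existence of an infinite component
    ([filled_percolates_finite]), so Kolmogorov's zero-one law makes this
    existence almost sure ([filled_percolates_supercritical]). The law of the
    seeds is determined by cylinders, which transfers the statement from one
    realisation to another.

    Probabilities being meaningful on measurable sets only, the events above are
    shown to be measurable through countable descriptions of components. *)

Import Order.TTheory GRing.Theory Num.Theory.
Local Open Scope classical_set_scope.
Local Open Scope ring_scope.
Set Implicit Arguments.
Unset Strict Implicit.
Unset Printing Implicit Defensive.

Import numFieldNormedType.Exports.

(* Otherwise these names denote notions about sequences and filters. *)
Local Notation adjacent := Defs.adjacent.
Local Notation cluster := Defs.cluster.

(** * Connected components under finite modifications *)

Lemma adjacent_sym d (x y : site d) : adjacent x y -> adjacent y x.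
Proof. by move=> [e [[-> ->]|[-> ->]]]; exists e; [right|left]. Qed.

Lemma linked_right d (A : set (site d)) x y : linked A x y -> A y.
Proof. by case. Qed.

Lemma linked_trans d (A : set (site d)) x y z :
  linked A x y -> linked A y z -> linked A x z.
Proof.
move=> xy; elim=> // u v _ xu uv Av; exact: linked_step xu uv Av.
Qed.

Lemma linked_sym d (A : set (site d)) x y : linked A x y -> linked A y x.
Proof.
elim=> [Ax|u v xu ux uv Av]; first exact: linked_refl.
apply: linked_trans ux.
apply: linked_step (adjacent_sym uv) (linked_right xu).
exact: linked_refl.
Qed.

Lemma linkedS d (A B : set (site d)) x y :
  A `<=` B -> linked A x y -> linked B x y.
Proof.
move=> AB; elim=> [/AB|u v _ xu uv /AB Bv]; first exact: linked_refl.
exact: linked_step xu uv Bv.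
Qed.

Lemma finite_neighbours d (x : site d) : finite_set (adjacent x).
Proof.
pose f (s : 'I_d * bool) : site d :=
  if s.2 then x + delta_mx 0 s.1 else x - delta_mx 0 s.1.
apply: (@sub_finite_set _ _ (range f)); last exact: finite_image.
move=> y [[a i] /= [[xa ya]|[xa ya]]].
  by exists (i, true) => //; rewrite /f /= xa ya.
by exists (i, false) => //; rewrite /f /= xa ya addrK.
Qed.

Definition neighbourhood d (F : set (site d)) : set (site d) :=
  \bigcup_(x in F) adjacent x.

Lemma finite_neighbourhood d (F : set (site d)) :
  finite_set F -> finite_set (neighbourhood F).
Proof. by move=> fF; apply: bigcup_finite => // x _; exact: finite_neighbours. Qed.

(** A path of [A'] from [x] either avoids [F], or runs after its last visit to
    [F] in the component in [A] of a neighbour of [F]. As [F] has finitely many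
    neighbours, finitely many components of [A] and [F] cover the component of
    [x] in [A']. *)
Lemma infinite_cluster_finite_diff d (A A' F : set (site d)) x :
  finite_set F -> A' `<=` A `|` F -> infinite_set (cluster A' x) ->
  exists z, infinite_set (cluster A z).
Proof.
move=> fF AF; apply: contra_notP => /forallNP fin.
have {}fin z : finite_set (cluster A z) by exact: contrapT (fin z).
apply: (@sub_finite_set _ _
  ((F `|` cluster A x) `|` \bigcup_(z in neighbourhood F) cluster A z)).
  move=> y; elim=> [A'x|u v _ IH uv A'v].
    by case: (AF _ A'x) => [Ax|Fx]; left; [right; exact: linked_refl|left].
  case: (AF _ A'v) => [Av|Fv]; last by left; left.
  case: IH => [[Fu|xu]|[z Fz zu]].
  - by right; exists v; [exists u|exact: linked_refl].
  - by left; right; exact: linked_step xu uv Av.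
  - by right; exists z => //; exact: linked_step zu uv Av.
rewrite !finite_setU; split; first by split.
by apply: bigcup_finite => //; exact: finite_neighbourhood.
Qed.

Lemma filledS d (S S' : set (site d)) : S `<=` S' -> filled S `<=` filled S'.
Proof.
move=> SS' x [/SS'|fin]; first by left.
right; apply: sub_finite_set fin => y; apply: linkedS; exact: subsetC.
Qed.

(** A site that becomes filled when the finite set [F] of seeds is added was
    joined to infinity by a path through [F]; just before [F], this path visits
    a neighbour of [F] lying in the finite component of the site. *)
Lemma finite_filled_diff d (S F : set (site d)) :
  finite_set F -> finite_set (filled (S `|` F) `\` filled S).
Proof.
move=> fF; pose C := cluster (~` (S `|` F)).
apply: (@sub_finite_set _ _ (F `|` \bigcup_(z in
    [set z | neighbourhood F z /\ finite_set (C z)]) C z)); last first.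
  rewrite finite_setU; split => //; apply: bigcup_finite; last by move=> z [].
  by apply: sub_finite_set (finite_neighbourhood fF) => z [].
move=> y [SFy /not_orP[nSy infy]].
case: SFy => [[//|Fy]|finy]; first by left.
have [Fy|nFy] := pselect (F y); first by left.
have SFy : (~` (S `|` F)) y by case.
suff [z Fz yz] : exists2 z, neighbourhood F z & C y z.
  right; exists z; last exact: linked_sym.
  by split=> //; apply: sub_finite_set finy => u zu; exact: linked_trans yz zu.
apply: contra_notP infy => /forall2NP noz.
apply: sub_finite_set finy => u; elim=> [_|v t _ yv vt nSt].
  exact: linked_refl.
apply: (linked_step yv vt) => -[//|Ft].
case: (noz v) => [nFv|/(_ yv)//]; apply: nFv; exists t => //.
exact: adjacent_sym.
Qed.

Definition filled_percolates d (S : set (site d)) : Prop :=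
  exists z, infinite_set (cluster (filled S) z).

(** More seeds fill more sites, so percolation is monotone; finitely many more
    seeds fill finitely many more sites, and these cannot create an infinite
    component out of finite ones. *)
Lemma filled_percolates_finite d (S S' F : set (site d)) : finite_set F ->
  S `<=` S' -> S' `<=` S `|` F -> filled_percolates S <-> filled_percolates S'.
Proof.
move=> fF SS' S'SF; split=> [[z infz]|[z infz]].
  exists z => fin; apply/infz/sub_finite_set/fin => y; apply: linkedS.
  exact: filledS.
apply: infinite_cluster_finite_diff (finite_filled_diff S fF) _ infz.
move=> y /(filledS S'SF) fy; rewrite setDE setUIr setUv setIT.
by right.
Qed.

(** * Connectivity of the lattice *)

(** Every site is reached from the origin by moving along coordinate axes. *)
Lemma lattice_ind d (Q : site d -> Prop) : Q 0 ->
  (forall x y, adjacent x y -> Q x -> Q y) -> forall x, Q x.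
Proof.
move=> Q0 Qadj.
have Qstep y i : (Q y -> Q (y + delta_mx 0 i)) /\ (Q y -> Q (y - delta_mx 0 i)).
  split; apply: Qadj; first by exists (y, i); left.
  by exists (y - delta_mx 0 i, i); right; rewrite /= subrK.
have Qline (k : int) y i : Q y -> Q (y + k *: delta_mx 0 i).
  move=> Qy; case: k => n; last first.
    rewrite NegzE scaleNr; elim: n.+1 => [|m IH]; first by rewrite scale0r subr0.
    by rewrite -[m.+1]addn1 PoszD scalerDl scale1r opprD addrA; apply: (Qstep _ _).2.
  elim: n => [|m IH]; first by rewrite scale0r addr0.
  by rewrite -[m.+1]addn1 PoszD scalerDl scale1r addrA; apply: (Qstep _ _).1.
move=> x; rewrite [x]row_sum_delta.
by elim/big_rec: _ => // i y _ Qy; rewrite addrC; exact: Qline.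
Qed.

(** * Measurability *)

Lemma measurable_exists disp (T : measurableType disp) (I : countType)
    (Q : I -> T -> Prop) :
  (forall i, measurable [set w | Q i w]) -> measurable [set w | exists i, Q i w].
Proof.
move=> mQ; rewrite (_ : [set w | _] = \bigcup_i [set w | Q i w]).
  by apply: countable_bigcupT_measurable => //; exact: countableP.
by apply/seteqP; split=> w [i]; [exists i|move=> _; exists i].
Qed.

Lemma measurable_forall disp (T : measurableType disp) (I : countType)
    (Q : I -> T -> Prop) :
  (forall i, measurable [set w | Q i w]) -> measurable [set w | forall i, Q i w].
Proof.
move=> mQ; rewrite (_ : [set w | _] = ~` [set w | exists i, ~ Q i w]).
  by apply/measurableC/measurable_exists => i; exact: measurableC (mQ i).
apply/seteqP; split=> [w h [i nQi]|w h i]; first exact: nQi (h i).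
by apply: contrapT => nQi; apply: h; exists i.
Qed.

Lemma measurable_Prop disp (T : measurableType disp) (Q : Prop) :
  measurable [set w : T | Q].
Proof.
have [q|nq] := pselect Q.
  by rewrite (_ : [set _ | _] = setT)//; apply/seteqP; split.
by rewrite (_ : [set _ | _] = set0)//; apply/seteqP; split.
Qed.

Lemma measurable_conj disp (T : measurableType disp) (Q Q' : T -> Prop) :
  measurable [set w | Q w] -> measurable [set w | Q' w] ->
  measurable [set w | Q w /\ Q' w].
Proof. exact: measurableI. Qed.

Lemma measurable_conj3 disp (T : measurableType disp) (Q Q' Q'' : T -> Prop) :
  measurable [set w | Q w] -> measurable [set w | Q' w] ->
  measurable [set w | Q'' w] -> measurable [set w | [/\ Q w, Q' w & Q'' w]].
Proof.
move=> mQ mQ' mQ''; rewrite (_ : [set w | _] = [set w | Q w /\ Q' w /\ Q'' w]).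
  by apply: measurable_conj => //; exact: measurable_conj.
by apply/seteqP; split=> w; [case|case=> ? []].
Qed.

(** Counting the steps reduces [linked], an inductive predicate, to countable
    unions and intersections. *)
Fixpoint linked_in d (n : nat) (A : set (site d)) (x y : site d) : Prop :=
  if n is n'.+1 then exists z, [/\ linked_in n' A x z, adjacent z y & A y]
  else A x /\ y = x.

Lemma linkedE d (A : set (site d)) x y :
  linked A x y <-> exists n, linked_in n A x y.
Proof.
split=> [|[n]].
  elim=> [Ax|u v _ [n xu] uv Av]; first by exists 0%N.
  by exists n.+1; exists u.
elim: n y => [|n IH] y /=; first by move=> [Ax ->]; exact: linked_refl.
by move=> [z [/IH xz zy Ay]]; exact: linked_step xz zy Ay.
Qed.

(** Boxes are finite and exhaust the lattice, so that infinity is a countable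
    condition. *)
Lemma infinite_unbounded d (A : set (site d)) :
  infinite_set A <-> forall n, exists y, A y /\ ~ box d n y.
Proof.
split=> [infA n|unb finA].
  apply: contra_notP infA => /forallNP Abox.
  apply: sub_finite_set (finite_box d n) => y Ay.
  by apply: contrapT => nby; exact: (Abox y).
(* The sum of all coordinates of all points, a bound for each of them. *)
pose N := (\sum_(x <- fset_set A) \sum_i absz (x ord0 i))%N.
have [y [Ay]] := unb N; apply => i.
have yA : y \in fset_set A by rewrite in_fset_set// inE.
rewrite -abszE lez_nat /N (big_fsetD1 y)//= (bigD1 i)//=.
by rewrite -!addnA leq_addr.
Qed.

Section measurable_cluster.
Context disp (T : measurableType disp) (d : nat) (B : T -> set (site d)).
Hypothesis mB : forall x, measurable [set w | B w x].

Lemma measurable_linked x y : measurable [set w | linked (B w) x y].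
Proof.
rewrite (_ : [set w | _] = [set w | exists n, linked_in n (B w) x y]); last first.
  by apply/seteqP; split=> w /linkedE.
apply: measurable_exists => n; elim: n y => [|n IH] y /=.
  by apply: measurable_conj => //; exact: measurable_Prop.
apply: measurable_exists => z.
by apply: measurable_conj3 => //; exact: measurable_Prop.
Qed.

Lemma measurable_infinite_cluster x :
  measurable [set w | infinite_set (cluster (B w) x)].
Proof.
rewrite (_ : [set w | _] =
    [set w | forall n, exists y, linked (B w) x y /\ ~ box d n y]); last first.
  by apply/seteqP; split=> w /infinite_unbounded.
apply: measurable_forall => n; apply: measurable_exists => y.
apply: measurable_conj; [exact: measurable_linked|exact: measurable_Prop].
Qed.

End measurable_cluster.

Lemma measurable_filled disp (T : measurableType disp) d
    (B : T -> set (site d)) : (forall x, measurable [set w | B w x]) ->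
  forall x, measurable [set w | filled (B w) x].
Proof.
move=> mB x.
suff mfin : measurable [set w | finite_set (cluster (~` B w) x)].
  exact: measurableU (mB x) mfin.
rewrite (_ : [set w | _] = ~` [set w | infinite_set (cluster (~` B w) x)]).
  apply/measurableC/(measurable_infinite_cluster (B := fun w => ~` B w)) => y.
  exact: measurableC (mB y).
by apply/seteqP; split=> w /=; [move=> fin; apply|move/contrapT].
Qed.

Lemma measurable_filled_percolates disp (T : measurableType disp) d
    (B : T -> set (site d)) : (forall x, measurable [set w | B w x]) ->
  measurable [set w | filled_percolates (B w)].
Proof.
move=> mB; apply: measurable_exists => z.
apply: (measurable_infinite_cluster (B := fun w => filled (B w))) => x.
exact: measurable_filled.
Qed.

Lemma measurable_origin_to_infinity disp (T : measurableType disp) d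
    (B : T -> set (site d)) : (forall x, measurable [set w | B w x]) ->
  measurable [set w | origin_to_infinity_filled (B w)].
Proof.
move=> mB; rewrite (_ : [set w | _] = [set w | exists y, adjacent 0 y /\
    infinite_set (cluster (filled (B w)) y)]); last first.
  by apply/seteqP; split=> w [y]; [exists y|case=> *; exists y].
apply: measurable_exists => z; apply: measurable_conj; first exact: measurable_Prop.
apply: (measurable_infinite_cluster (B := fun w => filled (B w))) => x.
exact: measurable_filled.
Qed.

(** * Boolean fields on the lattice and the zero-one law *)

(** Cylinders asking for open sites only: they are closed under intersection,
    and they suffice to generate the events. *)
Definition cylinder d (J : {fset site d}) : set (site d -> bool) :=
  [set s | forall x, x \in J -> s x].

Definition cylinders d : set (set (site d -> bool)) := range (@cylinder d).

Definition config d := g_sigma_algebraType (@cylinders d).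

Lemma cylinderU d (J K : {fset site d}) :
  cylinder (J `|` K)%fset = cylinder J `&` cylinder K.
Proof.
apply/seteqP; split=> [s sJK|s [sJ sK] x]; last by case/fsetUP => [/sJ|/sK].
by split=> x xJ; apply: sJK; rewrite in_fsetU xJ ?orbT.
Qed.

Lemma cylinder0 d : cylinder (@fset0 (site d)) = setT.
Proof. by apply/seteqP; split. Qed.

Lemma setI_closed_cylinders d : setI_closed (@cylinders d).
Proof.
by move=> _ _ [J _ <-] [K _ <-]; exists (J `|` K)%fset; rewrite ?cylinderU.
Qed.

Lemma measurable_cylinder d (J : {fset site d}) :
  measurable (cylinder J : set (config d)).
Proof. by apply: sub_sigma_algebra; exists J. Qed.

Lemma measurable_coordinate d x : measurable [set s : config d | s x].
Proof.
rewrite (_ : [set _ | _] = cylinder [fset x]%fset).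
  exact: measurable_cylinder.
by apply/seteqP; split=> [s sx y|s]; [rewrite inE => /eqP ->|apply; rewrite inE].
Qed.

Lemma measurable_preimage disp (T : measurableType disp) d (f : T -> config d)
    (E : set (config d)) :
  measurable_fun setT f -> measurable E -> measurable (f @^-1` E).
Proof. by move=> mf mE; rewrite -[X in measurable X]setTI; exact: mf. Qed.

Lemma measureC disp (T : measurableType disp) (R : realType)
    (m : {measure set T -> \bar R}) (A : set T) :
  (m setT < +oo)%E -> measurable A -> m (~` A) = (m setT - m A)%E.
Proof. by move=> moo mA; rewrite -[~` A]setTD measureD// setTI. Qed.

Section law_of_field.
Context disp (T : measurableType disp) (R : realType) (d : nat).

Lemma measurable_fun_config (f : T -> config d) :
  (forall x, measurable [set w | f w x]) -> measurable_fun setT f.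
Proof.
move=> mf.
apply: (@measurability _ _ _ (config d) setT f (@cylinders d)) => //.
move=> _ [_ [J _ <-] <-].
rewrite setTI (_ : _ @^-1` _ = \bigcap_(x in [set` J]) [set w | f w x]).
  by apply: fin_bigcap_measurable.
by apply/seteqP; split.
Qed.

(** Dynkin's theorem: a finite measure is determined on a generating class closed
    under intersection. *)
Lemma cylinders_determine disp' (T' : measurableType disp')
    (m : {measure set T -> \bar R}) (m' : {measure set T' -> \bar R})
    (f : T -> config d) (f' : T' -> config d) :
  measurable_fun setT f -> measurable_fun setT f' -> (m setT < +oo)%E ->
  (forall J, m (f @^-1` cylinder J) = m' (f' @^-1` cylinder J)) ->
  forall E, measurable E -> m (f @^-1` E) = m' (f' @^-1` E).
Proof.
move=> mf mf' moo mcyl.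
have mT : m setT = m' setT by have := mcyl fset0; rewrite cylinder0 !preimage_setT.
apply: (@dynkin_induction _ (config d) (@cylinders d)
  (fun E => m (f @^-1` E) = m' (f' @^-1` E))) => //.
- exact: setI_closed_cylinders.
- by move=> _ [J _ <-].
- move=> E mE IH.
  have mfE := measurable_preimage mf mE.
  have mfE' := measurable_preimage mf' mE.
  by rewrite (measureC moo mfE) measureC -?mT// IH.
- move=> F mF tF IH.
  have disj U (h : U -> config d) : trivIset setT (fun n => h @^-1` F n).
    apply/trivIsetP => i j _ _ ij; rewrite -preimage_setI.
    by move/trivIsetP : tF => -> //; rewrite preimage_set0.
  rewrite !preimage_bigcup !measure_bigcup//.
  + by apply: eq_eseriesr => n _; exact: IH.
  + by move=> n _; exact: measurable_preimage.
  + by move=> n _; exact: measurable_preimage.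
Qed.

(** Both sides are finite measures in [E], which agree on cylinders. *)
Lemma independent_of_cylinders (P : probability T R) (f : T -> config d) A :
  measurable_fun setT f -> measurable A ->
  (forall J, P (A `&` f @^-1` cylinder J) = P A * P (f @^-1` cylinder J))%E ->
  forall E, measurable E -> P (A `&` f @^-1` E) = (P A * P (f @^-1` E))%E.
Proof.
move=> mf mA Acyl E mE.
have fA : P A \is a fin_num by exact: fin_num_measure.
pose m := mrestr P mA.
pose r : {nonneg R} := NngNum (fine_ge0 (measure_ge0 P A)).
have mE' D : mscale r P D = (P A * P D)%E by rewrite /mscale /= fineK.
rewrite -mE' setIC; apply: (@cylinders_determine _ _ m (mscale r P)) => //.
- by rewrite /m /= /mrestr setTI ltey_eq fA.
- by move=> J; rewrite /m /= /mrestr setIC Acyl; exact/esym/mE'.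
Qed.

End law_of_field.

Section boolean_field.
Context disp (T : measurableType disp) (R : realType) (P : probability T R).
Context (d : nat) (S : site d -> {RV P >-> bool}).
Hypothesis indS : mutually_independent P (fun x => events_of (S x)).

Definition field : T -> config d := fun w x => S x w.

Lemma measurable_field_at x : measurable [set w | S x w].
Proof. by rewrite -[X in measurable X]setTI; exact: measurable_funP. Qed.

Lemma measurable_field : measurable_fun setT field.
Proof. by apply: measurable_fun_config; exact: measurable_field_at. Qed.

Lemma field_cylinder (J : {fset site d}) :
  P (field @^-1` cylinder J) = (\prod_(x <- J) P [set w | S x w])%E.
Proof.
rewrite -indS; last first.
  by move=> x _; exists [set true] => //; rewrite setTI.
by congr (P _); apply/seteqP; split.
Qed.

Let thinned (J : {fset site d}) : T -> config d :=
  fun w x => (x \notin J) && S x w.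

Let measurable_thinned J : measurable_fun setT (thinned J).
Proof.
apply: measurable_fun_config => x.
rewrite (_ : [set w | _] = [set w | x \notin J /\ S x w]).
  exact: measurable_conj (measurable_Prop _ _) (measurable_field_at x).
by apply/seteqP; split=> w /= => [/andP|[xJ Sx]]; last exact/andP.
Qed.

(** Closing the sites of [J] leaves a function of the other sites, independent
    of a cylinder over [J]: against a cylinder over [K] this is the product
    formula when [J] and [K] are disjoint, and otherwise both sides vanish. *)
Let thinned_independent J E : measurable E ->
  (P (field @^-1` cylinder J `&` thinned J @^-1` E) =
   P (field @^-1` cylinder J) * P (thinned J @^-1` E))%E.
Proof.
apply: independent_of_cylinders => //.
  exact: measurable_preimage measurable_field (measurable_cylinder J).
move=> K; have [JK|] := boolP [disjoint J & K]%fset; last first.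
  move=> /fset0Pn[x]; rewrite in_fsetI => /andP[xJ xK].
  rewrite (_ : thinned J @^-1` _ = set0) ?setI0 ?measure0 ?mule0//.
  by apply/seteqP; split=> w //= /(_ x xK); rewrite /thinned xJ.
have -> : thinned J @^-1` cylinder K = field @^-1` cylinder K.
  apply/seteqP; split=> w /= sK x xK; have := sK x xK.
    by case/andP.
  rewrite /thinned /field => ->; rewrite andbT.
  by apply/negP => xJ; move/fdisjointP/(_ _ xJ)/negP: JK.
rewrite -preimage_setI -cylinderU !field_cylinder -big_cat /=.
apply/perm_big/uniq_perm => [| |x]; first exact: fset_uniq.
  rewrite cat_uniq !fset_uniq andbT /=; apply/hasPn => x xK.
  by apply/negP => xJ; move/fdisjointP/(_ _ xJ)/negP: JK.
by rewrite in_fsetU mem_cat.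
Qed.

(** Kolmogorov: an event unaffected by closing the sites of [J] is independent of
    the cylinder over [J]; being so for every [J], it is independent of itself. *)
Lemma kolmogorov_zero_one (E : set (config d)) : measurable E ->
  (forall (J : {fset site d}) (s : site d -> bool),
     E (fun x => (x \notin J) && s x) <-> E s) ->
  P (field @^-1` E) = 0%E \/ P (field @^-1` E) = 1%E.
Proof.
move=> mE tailE.
have mfE := measurable_preimage measurable_field mE.
have indE D : measurable D ->
    P (field @^-1` E `&` field @^-1` D) = (P (field @^-1` E) * P (field @^-1` D))%E.
  apply: independent_of_cylinders measurable_field mfE _ D => J.
  have thinE : thinned J @^-1` E = field @^-1` E.
    by apply/seteqP; split=> w /=; apply tailE.
  by rewrite setIC -[in LHS]thinE thinned_independent// thinE muleC.
have := indE E mE; rewrite setIid.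
have fin : P (field @^-1` E) \is a fin_num by exact: fin_num_measure.
rewrite -(fineK fin) -EFinM => -[] /esym/eqP.
rewrite -subr_eq0 -[X in _ - X]mulr1 -mulrBr mulf_eq0 subr_eq0.
by case/orP => /eqP ->; [left|right].
Qed.

End boolean_field.

(** * Percolation of the filled seeds above the critical density *)

(** The probability of a cylinder is a product of marginals, so that the density
    determines the law of the seeds. This is what makes all realisations in the
    definition of the critical density equivalent. *)
Lemma seed_law_unique (R : realType) d (p : R)
    disp (T : measurableType disp) (P : probability T R)
    (S : site d -> {RV P >-> bool})
    disp' (T' : measurableType disp') (P' : probability T' R)
    (S' : site d -> {RV P' >-> bool}) :
  seed_field p S -> seed_field p S' ->
  forall E : set (config d), measurable E ->
    P (field S @^-1` E) = P' (field S' @^-1` E).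
Proof.
move=> [[S0 Sp] indS] [[S'0 S'p] indS'] E.
have PT : (P setT < +oo)%E by rewrite probability_setT ltry.
apply: (cylinders_determine (measurable_field S) (measurable_field S') PT) => J.
apply: (eq_trans (field_cylinder indS J)).
apply: (eq_trans _ (esym (field_cylinder indS' J))); apply: eq_bigr => x _.
have [->|x0] := eqVneq x 0; last by rewrite Sp ?S'p.
rewrite (_ : [set w | S 0 w] = set0); last by apply/seteqP; split=> w //=; rewrite S0.
rewrite (_ : [set w | S' 0 w] = set0) ?measure0//.
by apply/seteqP; split=> w //=; rewrite S'0.
Qed.

Lemma measurable_percolation_event d :
  measurable [set s : config d | filled_percolates [set x | s x]].
Proof.
apply: (measurable_filled_percolates (B := fun s : config d => [set x | s x])).
exact: measurable_coordinate.
Qed.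

Lemma filled_percolates_zero_one (R : realType) d disp (T : measurableType disp)
    (P : probability T R) (S : site d -> {RV P >-> bool}) :
  mutually_independent P (fun x => events_of (S x)) ->
  P [set w | filled_percolates [set x | S x w]] = 0%E \/
  P [set w | filled_percolates [set x | S x w]] = 1%E.
Proof.
move=> indS.
have := kolmogorov_zero_one indS (@measurable_percolation_event d); apply=> J s.
apply: (filled_percolates_finite (finite_fset J)).
  by move=> x /= /andP[].
by move=> x /= sx; have [xJ|xJ] := boolP (x \in J); [right|left].
Qed.

(** By the zero-one law, the probability could otherwise only be 0, and this in
    every realisation since they all have the same law; as a filled path from the
    origin to infinity is contained in an infinite filled component, [p] would
    then be one of the densities of which [pc_filled] is the supremum. *)
Lemma filled_percolates_supercritical (R : realType) d (p : R)
    disp (T : measurableType disp) (P : probability T R)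
    (S : site d -> {RV P >-> bool}) :
  seed_field p S -> 0 <= p <= 1 -> pc_filled R d < p ->
  P [set w | filled_percolates [set x | S x w]] = 1%E.
Proof.
move=> fieldS p01 pcp.
case: (filled_percolates_zero_one fieldS.2) => // perc0.
suff : p <= pc_filled R d by rewrite leNgt pcp.
apply: ub_le_sup; first by exists 1 => q [/andP[]].
split=> // disp' T' P' S' fieldS'.
have mS' := measurable_field_at S'.
apply/eqP; rewrite eq_le measure_ge0 andbT.
have <- : P' [set w | filled_percolates [set x | S' x w]] = 0%E.
  rewrite -perc0; symmetry.
  exact: seed_law_unique fieldS fieldS' _ (@measurable_percolation_event d).
apply: le_measure; rewrite ?inE.
- exact: (measurable_origin_to_infinity (B := fun w => [set x | S' x w])).
- exact: (measurable_filled_percolates (B := fun w => [set x | S' x w])).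
- by move=> w [y _ infy]; exists y.
Qed.

(** * Density of a set of sites *)

Lemma positive_density_ge (R : realType) d (A : set (site d)) (K N0 : nat) :
  (0 < K)%N ->
  (forall n, (N0 <= n)%N ->
     (n.*2.+1 ^ d <= K * #|` fset_set (A `&` box d n)|)%N) ->
  positive_density R A.
Proof.
move=> K0 AK; rewrite /positive_density limn_einf_lim.
apply: (@lt_le_trans _ _ (K%:R^-1)%:E); first by rewrite lte_fin invr_gt0 ltr0n.
apply: lime_ge; first exact: is_cvg_einfs.
exists N0 => // n /= N0n; apply: le_ereal_inf_tmp => _ [k /= nk <-].
rewrite lee_fin lter_pdivlMr ?exprn_gt0// mulrC ler_pdivrMr ?ltr0n//.
by rewrite -natrX -natrM ler_nat mulnC AK// (leq_trans N0n).
Qed.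

(** A finite set has density 0, its share of the box of radius [n] being at most
    a multiple of [1 / (n + 1)]. *)
Lemma positive_density_infinite (R : realType) d (A : set (site d)) :
  (0 < d)%N -> positive_density R A -> infinite_set A.
Proof.
move=> d0 + finA; rewrite /positive_density; set u := fun n : nat => _%:E.
suff u0 : u @ \oo --> 0%E by have [-> _] := cvg_limn_einf_sup u0; rewrite ltxx.
apply: cvg_EFin; first exact: nearW.
pose M := #|` fset_set A|.
have M0 : (fun n => M%:R * harmonic n : R) @ \oo --> (0 : R).
  rewrite -(mulr0 (M%:R : R)); apply: cvgMr; exact: cvg_harmonic.
apply: (squeeze_cvgr _ (cvg_cst 0) M0); apply: nearW => n.
rewrite /u /= divr_ge0 ?exprn_ge0//=.
apply: ler_pM => //.
  rewrite ler_nat; apply: fsubset_leq_card; rewrite -fset_set_sub//.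
  exact: finite_setIl.
rewrite lef_pV2 ?posrE ?exprn_gt0 ?ltr0n// -natrX ler_nat.
by rewrite -(prednK d0) expnS -addnn (leq_trans _ (leq_pmulr _ _)) ?expn_gt0//; lia.
Qed.

(** Enumerating a box by finite functions makes its cardinality explicit. *)
Definition box_sites d n : seq (site d) :=
  [seq \row_i ((g i : nat)%:Z - n%:Z) | g : {ffun 'I_d -> 'I_n.*2.+1}].

Lemma size_box_sites d n : size (box_sites d n) = (n.*2.+1 ^ d)%N.
Proof. by rewrite size_map -cardE card_ffun !card_ord. Qed.

Lemma uniq_box_sites d n : uniq (box_sites d n).
Proof.
rewrite map_inj_uniq ?enum_uniq// => g g' /rowP gg'; apply/ffunP => i.
by have := gg' i; rewrite !mxE => /addIr [] /val_inj.
Qed.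

Lemma box_sites_in_box d n x : x \in box_sites d n -> box d n x.
Proof.
move=> /mapP[g _ ->] i; rewrite mxE ler_norml.
by move: (nat_of_ord (g i)) (ltn_ord (g i)) => k; rewrite -addnn; lia.
Qed.

(** The origin is left out because it never hosts a seed. *)
Definition punctured_box d n : seq (site d) := rem 0 (box_sites d n).

Lemma count_punctured_box d n (A : pred (site d)) :
  (count A (punctured_box d n) <= #|` fset_set ([set x | A x] `&` box d n)|)%N.
Proof.
rewrite -size_filter; apply: uniq_leq_size.
  by rewrite filter_uniq// rem_uniq// uniq_box_sites.
move=> x; rewrite mem_filter => /andP[Ax xL].
rewrite in_fset_set; last exact/finite_setIr/finite_box.
by rewrite inE; split=> //; apply/box_sites_in_box/mem_rem/xL.
Qed.

(** * Density of the seeds *)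

Lemma independent_seq disp (T : measurableType disp) (R : realType)
    (P : probability T R) (I : choiceType) (F : I -> set (set T)) (s : seq I)
    (E : I -> set T) :
  mutually_independent P F -> uniq s -> (forall i, i \in s -> F i (E i)) ->
  P [set w | forall i, i \in s -> E i w] = (\prod_(i <- s) P (E i))%E.
Proof.
move=> indF us FE.
have sE i : (i \in [fset j in s]%fset) = (i \in s) by rewrite !inE.
have -> : (\prod_(i <- s) P (E i) = \prod_(i <- [fset j in s]%fset) P (E i))%E.
  by apply/perm_big/uniq_perm; rewrite ?fset_uniq// => i; rewrite sE.
rewrite -indF => [|i]; last by rewrite sE; exact: FE.
congr (P _); apply/seteqP; split=> w wE i /=; first by rewrite sE; exact: wE.
by move=> si; apply: wE; rewrite /= sE.
Qed.

Section seed_density.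
Context disp (T : measurableType disp) (R : realType) (P : probability T R).
Context (d : nat) (p : R) (S : site d -> {RV P >-> bool}).
Hypothesis fieldS : seed_field p S.

Let q (c : bool) : R := if c then p else 1 - p.

Let measurable_seed x c : measurable [set w | S x w = c].
Proof.
have mc : measurable [set c] by [].
by have := measurable_funP (S x) measurableT _ mc; rewrite setTI.
Qed.

Let seed_prob x c : x != 0 -> P [set w | S x w = c] = (q c)%:E.
Proof.
move=> x0; have Sx := fieldS.1.2 x x0.
case: c; first exact: Sx.
rewrite (_ : [set w | _] = ~` [set w | S x w]); last first.
  by apply/seteqP; split=> w /=; case: (S x w).
by rewrite probability_setC ?Sx//; exact: measurable_seed.
Qed.

Let pattern (k : seq (site d)) (b : site d -> bool) : set T :=
  [set w | forall x, x \in k -> S x w = b x].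

Let pattern_prob k b : uniq k -> 0 \notin k ->
  P (pattern k b) = (\prod_(x <- k) q (b x))%:E.
Proof.
move=> uk k0.
rewrite (independent_seq (E := fun x => [set w | S x w = b x]) fieldS.2)//.
  rewrite -prodEFin; apply: eq_big_seq => x xk; apply: seed_prob.
  by apply: contraNneq k0 => <-.
by move=> x _; exists [set b x] => //; rewrite setTI.
Qed.

Let measurable_pattern k b : measurable (pattern k b).
Proof.
apply: measurable_forall => x; have [xk|xk] := boolP (x \in k).
  rewrite (_ : [set w | _] = [set w | S x w = b x]); first exact: measurable_seed.
  by apply/seteqP; split=> [w /= ->//|w /= Sx _].
by rewrite (_ : [set w | _] = setT)//; apply/seteqP; split.
Qed.

Let few (l : seq (site d)) (m : nat) : set T :=
  [set w | (count (fun x => S x w) l <= m)%N].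

Let measurable_few l m : measurable (few l m).
Proof.
elim: l m => [|x l IH] m.
  by rewrite (_ : few _ _ = setT)//; apply/seteqP; split.
rewrite (_ : few _ _ = ([set w | S x w = false] `&` few l m) `|`
   ([set w | S x w = true] `&` (if m is m'.+1 then few l m' else set0))).
  by apply: measurableU; apply: measurableI => //; case: m.
apply/seteqP; split=> w; rewrite /few /=; case: (S x w) => /=.
- by case: m => [|m]; rewrite ?add1n//; right.
- by rewrite add0n; left.
- by case: m => [|m] [][]//; rewrite add1n.
- by case=> [][].
Qed.

(** Chernoff's bound: [1 - p / 2] is the expectation of [(1/2) ^ S x], and the
    sites are revealed one at a time, the revealed ones making up the pattern. *)
Let chernoff l k b m : uniq (k ++ l) -> 0 \notin k ++ l -> 0 <= p <= 1 ->
  (P (pattern k b `&` few l m) <=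
   (\prod_(x <- k) q (b x) * ((1 - p / 2) ^+ size l * 2 ^+ m))%:E)%E.
Proof.
move=> ukl kl0 p01.
have q0 c : 0 <= q c by case: c => /=; lra.
elim: l k b m ukl kl0 => [|x l IH] k b m ukl kl0.
  rewrite cats0 in ukl kl0.
  apply: (@le_trans _ _ (P (pattern k b))); first exact: measureIl.
  rewrite pattern_prob// lee_fin expr0 mul1r ler_peMr ?prodr_ge0//.
  by rewrite exprn_ege1// ler1n.
(* The pattern in which [x] has been revealed to be in state [c]. *)
pose b' c y := if y == x then c else b y.
have xk : x \notin k.
  by apply/negP => xk; move: ukl; rewrite cat_uniq /= xk/= andbF.
have ukl' : uniq ((x :: k) ++ l) by move: ukl; rewrite -cat1s uniq_catCA.
have kl0' : 0 \notin (x :: k) ++ l.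
  by move: kl0; rewrite !mem_cat !inE !negb_or => /and3P[-> -> ->].
have prod_b' c : \prod_(y <- x :: k) q (b' c y) = q c * \prod_(y <- k) q (b y).
  rewrite big_cons /b' eqxx; congr (_ * _); apply: eq_big_seq => y yk.
  by case: eqP => // yx; rewrite -yx yk in xk.
have bound c m' := IH (x :: k) (b' c) m' ukl' kl0'.
have pat c w : pattern k b w -> S x w = c -> pattern (x :: k) (b' c) w.
  move=> kw Sc y; rewrite inE /b'; case: eqP => [-> _ //|_ /=]; exact: kw.
set A := \prod_(y <- k) q (b y) in prod_b' *.
have A0 : 0 <= A by apply: prodr_ge0.
set r := (1 - p / 2) ^+ size l.
have r0 : 0 <= r by rewrite exprn_ge0//; lra.
have Ar0 : 0 <= A * r by rewrite mulr_ge0.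
(* With [m = 0], the site [x] cannot be a seed. *)
case: m => [|m].
  apply: le_trans (_ : P (pattern (x :: k) (b' false) `&` few l 0) <= _)%E.
    apply: le_measure; rewrite ?inE; [exact: measurableI|exact: measurableI|].
    move=> w [kw]; rewrite /few /=; case Sx: (S x w) => // lw.
    by split=> //; exact: pat.
  apply: le_trans (bound _ _) _; rewrite prod_b' -/r lee_fin /= expr0 exprS -/r.
  nra.
apply: le_trans (_ : P ((pattern (x :: k) (b' false) `&` few l m.+1) `|`
   (pattern (x :: k) (b' true) `&` few l m)) <= _)%E.
  apply: le_measure; rewrite ?inE; [exact: measurableI|
    by apply: measurableU; exact: measurableI|].
  move=> w [kw]; rewrite /few /=; case Sx: (S x w) => lw.
    by right; split=> //; exact: pat.
  by left; split=> //; exact: pat.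
apply: le_trans (measureU2 _ _ _) _; [exact: measurableI|exact: measurableI|].
apply: le_trans (leeD (bound _ _) (bound _ _)) _.
rewrite !prod_b' -EFinD lee_fin /= -/r !exprS -/r.
have m0 : 0 <= 2 ^+ m :> R by rewrite exprn_ge0.
nra.
Qed.

(** Apply Chernoff's bound to the punctured boxes: if [(1 - p / 2) ^ K] is at most
    [1 / 4], the probability to see at most [N / K] seeds among [N] sites is at
    most [2 ^ - (N / K)], which is summable over the boxes as [N] grows at least
    quadratically; the Borel-Cantelli lemma concludes. *)
Lemma seeds_positive_density : 0 < p <= 1 -> (2 <= d)%N ->
  {ae P, forall w, positive_density R [set x | S x w]}.
Proof.
move=> /andP[p0 p1] d2.
have p01 : 0 <= p <= 1 by rewrite ltW.
have [K K0 rK] : exists2 K, (0 < K)%N & (1 - p / 2) ^+ K <= 4^-1.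
  have r1 : `|1 - p / 2| < 1 by rewrite ltr_norml; lra.
  have /cvgrPdist_le/(_ 4^-1) := cvg_expr r1.
  rewrite invr_gt0 ltr0n => /(_ isT)[N _ Nr]; exists N.+1 => //.
  have := Nr N.+1 (leqnSn N); rewrite sub0r normrN ger0_norm//.
  by rewrite exprn_ge0//; lra.
pose L n := punctured_box d n.
have sizeL n : (n.*2.+1 ^ d).-1 = size (L n).
  rewrite /L /punctured_box size_rem ?size_box_sites//.
  apply/mapP; exists [ffun=> inord n]; first by rewrite mem_enum.
  apply/rowP => i; rewrite !mxE ffunE inordK ?subrr//.
  by rewrite ltnS -addnn leq_addr.
have K_L n : (n * n <= size (L n))%N.
  rewrite -sizeL -ltnS prednK ?expn_gt0//.
  apply: leq_trans (_ : n.*2.+1 ^ 2 <= _)%N; last exact: leq_pexp2l.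
  by rewrite -addnn; nia.
pose m n := (size (L n) %/ K)%N.
(* Shifting by [K] gives [N / K >= n + 1], as [N >= (n + K) ^ 2]. *)
pose F n := few (L (n + K)%N) (m (n + K)%N).
have PF n : (P (F n) <= (1 / (2 ^ (n + 1))%:R)%:E)%E.
  set n' := (n + K)%N.
  apply: (@le_trans _ _ (P (pattern [::] (fun=> false) `&` F n))).
    apply: le_measure; rewrite ?inE; [exact: measurable_few| |by move=> w Fw; split].
    by apply: measurableI => //; exact: measurable_few.
  apply: le_trans (chernoff _ _ _ _ p01) _.
  - by rewrite rem_uniq// uniq_box_sites.
  - by rewrite mem_rem_uniqF ?uniq_box_sites.
  rewrite big_nil mul1r lee_fin div1r natrX.
  have r01 : 0 <= 1 - p / 2 <= 1 by lra.
  apply: (@le_trans _ _ ((4^-1) ^+ m n' * 2 ^+ m n')).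
    apply: ler_wpM2r; first exact: exprn_ge0.
    apply: (@le_trans _ _ ((1 - p / 2) ^+ (K * m n'))).
      by apply: ler_wiXn2l; [lra|lra|rewrite mulnC leq_divM].
    by rewrite exprM lerXn2r ?nnegrE ?exprn_ge0 ?invr_ge0//; lra.
  rewrite -exprMn (_ : 4^-1 * 2 = 2^-1); last by field.
  rewrite -exprVn; apply: ler_wiXn2l; [lra|lra|].
  rewrite leq_divRL// (leq_trans _ (K_L n'))// leq_mul// /n'; lia.
have F0 : P (lim_sup_set F) = 0.
  apply: lim_sup_set_cvg0 => [n|]; first exact: measurable_few.
  apply: (@le_lt_trans _ _ (\sum_(n <oo) (1 / (2 ^ (n + 1))%:R)%:E)%E).
    by apply: lee_nneseries => n _ //; exact: PF.
  by rewrite (cvg_lim _ (@cvg_geometric_eseries_half R 1 0))// ltry.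
exists (lim_sup_set F); split=> //.
  by apply: bigcapT_measurable => n; apply: bigcup_measurable => k _;
    exact: measurable_few.
move=> w; apply: contra_notP => /existsNP[N] /not_implyP[_ NF].
apply: (positive_density_ge (N0 := N + K) R K0) => n Nn.
have Kn : (K <= n)%N by lia.
apply: leq_trans (_ : K * count (fun x => S x w) (L n) <= _)%N; last first.
  by rewrite leq_mul2l (count_punctured_box n (fun x => S x w)) orbT.
rewrite -(prednK (_ : 0 < n.*2.+1 ^ d)%N) ?expn_gt0// sizeL mulnC -ltn_divLR//.
rewrite ltnNge; apply/negP => cm; apply: NF; exists (n - K)%N => /=; first lia.
by rewrite /F subnK//; exact: cm.
Qed.

End seed_density.

(** * Cheap paths *)

Lemma ae_forall_countable disp (T : measurableType disp) (R : realType)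
    (P : {measure set T -> \bar R}) (I : countType) (Q : I -> T -> Prop) :
  (forall i, {ae P, forall w, Q i w}) -> {ae P, forall w, forall i, Q i w}.
Proof.
move=> aeQ.
have : {ae P, forall w, forall n (i : I), choice.unpickle n = Some i -> Q i w}.
  apply: ae_foralln => n; case: (@choice.unpickle I n) => [i|]; last exact: aeW.
  by apply: filterS (aeQ i) => w Qw _ [<-].
by apply: filterS => w Qw i; apply: (Qw (choice.pickle i)); rewrite choice.pickleK.
Qed.

(** The density of the exponential law of rate 1 is at most 1; this follows here
    from [1 - exp (- eps) <= eps]. *)
Lemma exponential_prob_le (R : realType) (eps : R) : 0 < eps ->
  (exponential_prob 1 `]-oo, eps] <= eps%:E)%E.
Proof.
move=> eps0.
have -> : exponential_prob 1 `]-oo, eps] = exponential_prob 1 `[0, eps].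
  have nneg (D : set R) : exponential_prob 1 D = exponential_prob 1 (D `&` `[0, +oo[).
    rewrite /exponential_prob integral_mkcondr; apply: eq_integral => x _.
    rewrite patchE; case: ifPn => //; rewrite notin_setE /= in_itv/= andbT => /negP.
    by rewrite -ltNge => /lt0_exponential_pdf ->.
  rewrite nneg [RHS]nneg; congr exponential_prob.
  apply/seteqP; split=> x /=; rewrite !in_itv/= ?andbT.
    by case=> -> ->.
  by case=> /andP[_ ->] ->.
rewrite exponential_prob_itv0c// -EFinB lee_fin lerBlDr -lerBlDl mulN1r.
exact: expR_ge1Dx.
Qed.

Lemma union_bound disp (T : measurableType disp) (R : realType)
    (P : probability T R) (I : eqType) (l : seq I) (A : I -> set T) (c : R) :
  (forall i, measurable (A i)) -> (forall i, i \in l -> P (A i) <= c%:E)%E ->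
  measurable [set w | exists2 i, i \in l & A i w] /\
  (P [set w | exists2 i, i \in l & A i w] <= (c *+ size l)%:E)%E.
Proof.
move=> mA; elim: l => [|i l IH] Ac.
  rewrite (_ : [set w | _] = set0); first by rewrite measure0.
  by apply/seteqP; split=> w // [].
have [j jl|mU PU] := IH; first by apply: Ac; rewrite inE jl orbT.
rewrite (_ : [set w | _] = A i `|` [set w | exists2 i, i \in l & A i w]).
  split; first exact: measurableU.
  apply: le_trans (measureU2 _ _ _) _ => //.
  by rewrite mulrS EFinD; apply: leeD => //; apply: Ac; rewrite mem_head.
apply/seteqP; split=> w /=.
  by case=> j; rewrite inE => /predU1P[->|jl] Aj; [left|right; exists j].
case=> [Ai|[j jl Aj]]; first by exists i; rewrite ?mem_head.
by exists j; rewrite // inE jl orbT.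
Qed.

(** Each edge at [z] comes with the site where it leads. *)
Definition steps d (z : site d) : seq (edge d * site d) :=
  [seq ((z, i), z + delta_mx 0 i) | i <- enum 'I_d] ++
  [seq ((z - delta_mx 0 i, i), z - delta_mx 0 i) | i <- enum 'I_d].

Lemma steps_joins d (z y : site d) e : joins e z y -> (e, y) \in steps z.
Proof.
case: e => a i [] /= [-> ->]; rewrite mem_cat; apply/orP; [left|right].
  by apply/mapP; exists i; rewrite ?mem_enum.
by apply/mapP; exists i; rewrite ?mem_enum// addrK.
Qed.

(** Walks are recorded by the edges they use, where the clocks are. *)
Fixpoint walks d n (z : site d) : seq (seq (edge d)) :=
  if n is n'.+1 then
    flatten [seq [seq s.1 :: es | es <- walks n' s.2] | s <- steps z]
  else [:: [::]].

Lemma size_walks d n (z : site d) : size (walks n z) = ((d + d) ^ n)%N.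
Proof.
elim: n z => //= n IH z; rewrite size_flatten /shape -map_comp expnS.
set k := ((d + d) ^ n)%N in IH *.
have size_dir U (f : 'I_d -> U) : size [seq f i | i <- enum 'I_d] = d.
  by rewrite size_map size_enum_ord.
have -> : (d + d = size (steps z))%N by rewrite size_cat !size_dir.
by elim: (steps z) => //= s l ->; rewrite size_map IH mulSn.
Qed.

Lemma size_walk d n (z : site d) es : es \in walks n z -> size es = n.
Proof.
elim: n z es => [|n IH] z es /=; first by rewrite inE => /eqP ->.
by case/flatten_mapP => s _ /mapP[es' /IH <- ->].
Qed.

Lemma walk_in_walks d (x : nat -> site d) (e : nat -> edge d) N n :
  (forall k, joins (e k) (x k) (x k.+1)) ->
  [seq e k | k <- iota N n] \in walks n (x N).
Proof.
move=> joe; elim: n N => [|n IH] N /=; first by rewrite inE.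
apply/flatten_mapP; exists (e N, x N.+1); first exact: steps_joins.
by apply/mapP; exists [seq e k | k <- iota N.+1 n].
Qed.

(** The walks are restricted to repeat no edge, so that independence applies. *)
Definition cheap_walk (R : realType) d (t : edge d -> R) (eps : R) n z : Prop :=
  exists2 es, es \in walks n z & uniq es /\ forall e, e \in es -> t e <= eps.

Section cheap_walks.
Context disp (T : measurableType disp) (R : realType) (P : probability T R).
Context (d : nat) (t : edge d -> {RV P >-> R}).
Hypothesis indt : mutually_independent P (fun e => events_of (t e)).
Hypothesis small : forall e (eps : R), 0 < eps ->
  (P [set w | (t e w <= eps)%R] <= eps%:E)%E.

Let measurable_le e eps : measurable [set w | t e w <= eps].
Proof.
have := measurable_funP (t e) measurableT _ (measurable_itv `]-oo, eps]).
by rewrite setTI.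
Qed.

Let cheap_walk_prob (eps : R) n z : 0 < eps ->
  measurable [set w | cheap_walk (t^~ w) eps n z] /\
  (P [set w | cheap_walk (t^~ w) eps n z] <= ((eps *+ (d + d)) ^+ n)%:E)%E.
Proof.
move=> eps0; pose A es : set T := [set w | uniq es /\ forall e, e \in es -> t e w <= eps].
have mA es : measurable (A es).
  apply: measurable_conj; first exact: measurable_Prop.
  apply: measurable_forall => e; have [ee|ee] := boolP (e \in es).
    rewrite (_ : [set w | _] = [set w | t e w <= eps]); first exact: measurable_le.
    by apply/seteqP; split=> [w /= ->//|w /= Sx _].
  by rewrite (_ : [set w | _] = setT)//; apply/seteqP; split.
have PA es : es \in walks n z -> (P (A es) <= (eps ^+ n)%:E)%E.
  move=> /size_walk <-; have [ues|nes] := boolP (uniq es); last first.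
    rewrite (_ : A es = set0) ?measure0 ?lee_fin ?exprn_ge0 ?ltW//.
    by apply/seteqP; split=> w // []; rewrite (negPf nes).
  rewrite (_ : A es = [set w | forall e, e \in es -> [set w | t e w <= eps] w]).
    rewrite (independent_seq indt)//; last first.
      move=> e _; exists `]-oo, eps]%classic; first exact: measurable_itv.
      by rewrite setTI; apply/seteqP; split=> w /=; rewrite in_itv.
    elim: es {ues} => [|e es IH]; first by rewrite big_nil.
    rewrite big_cons exprS EFinM; apply: lee_pmul => //; last exact: small.
    by apply: prode_ge0 => e' _.
  by apply/seteqP; split=> [w []|w].
have [mU PU] := union_bound mA PA; split => //.
apply: le_trans PU _; rewrite size_walks lee_fin.
by rewrite -[in leRHS]mulr_natr exprMn -natrX mulr_natr.
Qed.

(** There are at most [(2 d) ^ n] walks of [n] steps from a site, each of them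
    cheap with probability at most [eps ^ n]. *)
Lemma no_long_cheap_walk (eps : R) : 0 < eps -> eps *+ (d + d) < 1 ->
  {ae P, forall w, forall z, exists n, ~ cheap_walk (t^~ w) eps n z}.
Proof.
move=> eps0 eps1; apply: ae_forall_countable => z.
exists (\bigcap_n [set w | cheap_walk (t^~ w) eps n z]); split.
- by apply: bigcapT_measurable => n; have [] := cheap_walk_prob n z eps0.
- apply/eqP; rewrite eq_le measure_ge0 andbT.
  have r0 : `|eps *+ (d + d)| < 1 by rewrite ger0_norm// mulrn_wge0// ltW.
  have lim0 : ((eps *+ (d + d)) ^+ n)%:E @[n --> \oo] --> 0%E.
    by apply: cvg_EFin; [exact: nearW|exact: cvg_expr].
  rewrite -(cvg_lim _ lim0)//.
  apply: lime_ge; [by apply/cvg_ex; exists 0%E|apply: nearW => n].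
  have [mc Pc] := cheap_walk_prob n z eps0; apply: le_trans Pc.
  apply: le_measure; rewrite ?inE//; last exact: bigcap_inf.
  by apply: bigcapT_measurable => k; have [] := cheap_walk_prob k z eps0.
- by move=> w /forallNP cheap n _; exact: contrapT (cheap n).
Qed.

(** A clock is nonpositive with probability at most [eps] for all [eps]. *)
Lemma clocks_positive : {ae P, forall w, forall e, 0 < t e w}.
Proof.
apply: ae_forall_countable => e; exists [set w | t e w <= 0]; split => //.
- apply/eqP; rewrite eq_le measure_ge0 andbT; apply/lee_addgt0Pr => eps eps0.
  rewrite add0e; apply: le_trans (small e eps0).
  apply: le_measure; rewrite ?inE// => w /= /le_trans; apply; exact: ltW.
- by move=> w /=; rewrite ltNge => /negP/negPn.
Qed.

End cheap_walks.

(** * The dynamics *)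

Lemma joins_sym d (e : edge d) x y : joins e x y -> joins e y x.
Proof. by move=> [[-> ->]|[-> ->]]; [right|left]. Qed.

Lemma joins_eq d (e : edge d) x y x' y' :
  joins e x y -> joins e x' y' -> x = x' \/ x = y'.
Proof.
by move=> [[-> _]|[-> _]] [[-> ->]|[-> ->]]; [left|right|right|left].
Qed.

Section dynamics.
Context (R : realType) (d : nat) (seed : site d -> bool).
Context (t tlambda : edge d -> R) (tau : site d -> \bar R) (kind : site d -> bool).
Hypothesis rules : fpphe_rules seed t tlambda tau kind.

Lemma all_occupied x : (tau x < +oo)%E.
Proof.
elim/lattice_ind: x => [|x y [e xy] taux]; first by rewrite (origin_time rules) ltry.
apply: le_lt_trans (occupied_no_later rules xy) _.
by rewrite lte_add_pinfty// ltry.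
Qed.

Let time x : R := fine (tau x).

Let tauE x : tau x = (time x)%:E.
Proof. by rewrite fineK// ge0_fin_numE ?(nonneg_time rules)// all_occupied. Qed.

Let time_ge0 x : 0 <= time x.
Proof. by rewrite fine_ge0// (nonneg_time rules). Qed.

Lemma FPP1_not_seed y : seed 0 = false -> kind y = FPP1 -> seed y = false.
Proof.
move=> seed0 y1; have [->//|y0] := eqVneq y 0.
have [x [e [_ _]]] := occupied_by_attempt rules y0 (all_occupied y).
by rewrite y1; case: (seed y); rewrite ?orbT.
Qed.

Lemma FPP1_predecessor y : kind y = FPP1 -> y != 0 ->
  exists x e, [/\ joins e x y, kind x = FPP1 & time y = time x + t e].
Proof.
move=> y1 y0; have [x [e [xy tauy]]] := occupied_by_attempt rules y0 (all_occupied y).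
rewrite y1; case kx: (kind x) => //= _; exists x, e; split=> //.
by move: tauy; rewrite !tauE kx -EFinD => -[].
Qed.

Hypothesis t_gt0 : forall e, 0 < t e.
Variable eps : R.
Hypothesis eps_gt0 : 0 < eps.
Hypothesis no_cheap : forall z, exists n, ~ cheap_walk t eps n z.

(** Along an infinite chain of predecessors the occupation times decrease, and
    being nonnegative they converge: eventually every step takes time at most
    [eps], and these steps make up arbitrarily long cheap walks. *)
Lemma no_infinite_chain (x : nat -> site d) (e : nat -> edge d) :
  (forall k, joins (e k) (x k) (x k.+1)) ->
  ~ (forall k, time (x k) = time (x k.+1) + t (e k)).
Proof.
move=> joe timeE.
have time_decr j k : (j < k)%N -> time (x k) < time (x j).
  apply: (@homo_ltn _ (fun i => time (x i)) (fun a b => b < a)) => [b a c ba cb|i].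
    exact: lt_trans cb ba.
  by rewrite [ltRHS]timeE ltrDl.
have e_inj : injective e.
  suff e_lt j k : (j < k)%N -> e j <> e k.
    move=> j k ejk; case: (ltngtP j k) => [jk|kj|//].
      by case: (e_lt _ _ jk).
    by case: (e_lt _ _ kj).
  move=> jk ejk; have := joe j; rewrite ejk => /joins_eq/(_ (joe k))[] xE.
    by have := time_decr _ _ jk; rewrite xE ltxx.
  by have := time_decr _ _ (ltnW jk : j < k.+1)%N; rewrite xE ltxx.
have cheap : \forall k \near \oo, t (e k) <= eps.
  have /cvg_ex[l timel] : cvgn (fun k => time (x k)).
    apply: nonincreasing_is_cvgn; last by exists 0 => _ [k _ <-].
    by apply/nonincreasing_seqP => k; rewrite ltW// time_decr.
  have t0 : (fun k => time (x k) - time (x k.+1)) @ \oo --> (l - l : R).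
    by apply: cvgB => //; have := timel; rewrite -(cvg_shiftS (fun k => time (x k))).
  have /cvgrPdist_le/(_ eps eps_gt0) := t0; rewrite subrr.
  apply: filterS => k; rewrite sub0r normrN timeE addrAC subrr add0r.
  by rewrite ger0_norm// ltW.
case: cheap => N _ cheapN; have [n] := no_cheap (x N); apply.
exists [seq e k | k <- iota N n]; first exact: walk_in_walks.
split=> [|_ /mapP[k + ->]]; first by rewrite map_inj_uniq ?iota_uniq.
by rewrite mem_iota => /andP[Nk _]; exact: cheapN.
Qed.

Let occ k : set (site d) := [set x | (tau x < +oo)%E /\ kind x = k].

(** Predecessors of sites of [FPP1] belong to [FPP1]; as they cannot be traced
    back forever, the trace ends at the origin. *)
Lemma FPP1_linked y : kind y = FPP1 -> linked (occ FPP1) 0 y.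
Proof.
pose bad y := kind y = FPP1 /\ ~ linked (occ FPP1) 0 y.
have occE z : kind z = FPP1 -> occ FPP1 z by split=> //; exact: all_occupied.
have l0 : linked (occ FPP1) 0 0.
  by apply: linked_refl; apply: occE; exact: (origin_kind rules).
have next (u : {y | bad y}) : {v : {y | bad y} * edge d |
    joins v.2 (sval u) (sval v.1) /\
    time (sval u) = time (sval v.1) + t v.2}.
  apply: cid; case: u => z [z1 nlz] /=.
  have z0 : z != 0 by apply: contra_notN nlz => /eqP ->.
  have [x [e [xz x1 timez]]] := FPP1_predecessor z1 z0.
  have badx : bad x.
    split=> // lx; apply: nlz; apply: (linked_step lx); last exact: occE.
    by exists e.
  by exists (exist _ x badx, e) => /=; split=> //; exact: joins_sym.
move=> y1; apply: contrapT => nly.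
(* The chain of predecessors never meets the origin, as its sites are bad. *)
pose u k := iter k (fun v => (sval (next v)).1) (exist _ y (conj y1 nly)).
apply: (@no_infinite_chain (fun k => sval (u k)) (fun k => (sval (next (u k))).2)).
  by move=> k; exact: (svalP (next (u k))).1.
by move=> k; exact: (svalP (next (u k))).2.
Qed.

(** If [FPP1] escapes to infinity, it does so through the unseeded component of
    the origin, which therefore contains no filled site. *)
Lemma filled_occupied_by_lambda : seed 0 = false -> infinite_set (occ FPP1) ->
  filled [set x | seed x] `<=` occ FPPlambda.
Proof.
move=> seed0 inf1 x fx; split; first exact: all_occupied.
case kx: (kind x) => //; exfalso.
have occS : occ FPP1 `<=` ~` [set x | seed x].
  by move=> z [_ /(FPP1_not_seed seed0)] /= ->.
have lx := FPP1_linked kx.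
case: fx => [|fin]; first exact: occS (linked_right lx).
apply/inf1/sub_finite_set/fin => z [_ /FPP1_linked lz].
apply: linkedS occS _; exact: linked_trans (linked_sym lx) lz.
Qed.

End dynamics.

(** * Coexistence *)

Lemma ae_measure_gt0 disp (T : measurableType disp) (R : realType)
    (P : probability T R) (A B : set T) :
  measurable A -> measurable B -> {ae P, forall w, A w -> B w} ->
  (0 < P A)%E -> (0 < P B)%E.
Proof.
move=> mA mB [N [mN N0 AB]] /lt_le_trans; apply.
apply: (@le_trans _ _ (P (B `|` N))); last by rewrite measureU0.
apply: le_measure; rewrite ?inE//; first exact: measurableU.
move=> w Aw; have [Bw|nBw] := pselect (B w); first by left.
by right; apply: AB => /(_ Aw).
Qed.

Lemma positive_densityS (R : realType) d (A B : set (site d)) :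
  A `<=` B -> positive_density R A -> positive_density R B.
Proof.
move=> AB /lt_le_trans; apply; rewrite !limn_einf_lim.
apply: lee_lim; [exact: is_cvg_einfs|exact: is_cvg_einfs|].
apply: nearW => n; apply: le_ereal_inf_tmp => _ [k /= nk <-].
apply: ge_ereal_inf; eexists; first by exists k.
rewrite lee_fin ler_pM2r ?invr_gt0 ?exprn_gt0// ler_nat.
apply: fsubset_leq_card; rewrite -fset_set_sub; first exact: setSI.
all: exact/finite_setIr/finite_box.
Qed.

Lemma card_fset_set_box (R : realType) d n (A : set (site d)) :
  (#|` fset_set (A `&` box d n)|)%:R = \sum_(x <- fset_set (box d n)) \1_A x :> R.
Proof.
have fA : finite_set (A `&` box d n) by exact/finite_setIr/finite_box.
rewrite (perm_size (s2 := [seq x <- fset_set (box d n) | x \in A])).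
  rewrite size_filter -sum1_count natr_sum big_mkcond /=.
  by apply: eq_bigr => x _; rewrite indicE; case: (x \in A).
apply: uniq_perm; rewrite ?filter_uniq ?fset_uniq// => x; rewrite mem_filter.
by rewrite !in_fset_set ?in_setI//; exact: finite_box.
Qed.

Lemma measurable_positive_density (R : realType) disp (T : measurableType disp)
    d (B : T -> set (site d)) : (forall x, measurable [set w | B w x]) ->
  measurable [set w | positive_density R (B w)].
Proof.
move=> mB; pose u n w : \bar R :=
  ((#|` fset_set (B w `&` box d n)|)%:R / ((n.*2.+1)%:R ^+ d))%:E.
have mun n : measurable_fun setT (u n).
  rewrite (_ : u n = EFin \o (fun w => (\sum_(x <- fset_set (box d n))
      \1_[set w | B w x] w) / ((n.*2.+1)%:R ^+ d))); last first.
    apply/funext => w; rewrite /u /=; congr (_ / _)%:E.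
    rewrite card_fset_set_box; apply: eq_bigr => x _.
    by rewrite !indicE; congr (nat_of_bool _)%:R; apply/idP/idP; rewrite !inE.
  apply/measurable_EFinP; apply: measurable_funM => //.
  by apply: measurable_sum => x; exact: measurable_indic.
have mlim : measurable_fun setT (fun w => limn_einf (u^~ w)).
  apply: measurableT_comp => //.
  apply: measurable_fun_limn_esup => n.
  by apply: measurableT_comp (mun n).
rewrite (_ : [set w | _] = (fun w => limn_einf (u^~ w)) @^-1` `]0%E, +oo[); last first.
  by apply/seteqP; split=> w /=; rewrite in_itv/= andbT.
by rewrite -[X in measurable X]setTI; apply: mlim => //; exact: emeasurable_itv.
Qed.

Lemma mutually_independent_pcan disp (T : measurableType disp) (R : realType)
    (P : probability T R) (I I' : choiceType) (F : I' -> set (set T))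
    (f : I -> I') (g : I' -> option I) : pcancel f g ->
  mutually_independent P F -> mutually_independent P (F \o f).
Proof.
move=> fK indF J E FE.
pose E' i' := if g i' is Some i then E i else setT.
have E'f i : E' (f i) = E i by rewrite /E' fK.
transitivity (P [set w | forall i', i' \in map f J -> E' i' w]).
  congr (P _); apply/seteqP; split=> w wE.
    by move=> _ /mapP[i iJ ->]; rewrite E'f; exact: wE.
  by move=> i /= iJ; rewrite -E'f; apply: wE; exact: map_f.
rewrite (independent_seq indF) ?big_map//.
- by apply: eq_bigr => i _; rewrite E'f.
- by rewrite map_inj_uniq ?fset_uniq//; exact: pcan_inj fK.
- by move=> _ /mapP[i iJ ->]; rewrite E'f; exact: FE.
Qed.

Section occupied_events.
Context (R : realType) (d : nat) (p lambda : R) disp (T : measurableType disp).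
Context (P : probability T R) (X : fpphe d p lambda P).

Lemma measurable_occupied k x : measurable [set w | occupied X k w x].
Proof.
have mtau := measurable_funP (tau X x) measurableT.
have mkind := measurable_funP (kind X x) measurableT.
apply: measurable_conj.
  rewrite (_ : [set w | _] = ~` (tau X x @^-1` [set +oo%E])).
    by apply: measurableC; rewrite -[X in measurable X]setTI; exact: mtau.
  by apply/seteqP; split=> w /=; rewrite ltey => /eqP.
have mk : measurable [set k] by [].
by have := mkind _ mk; rewrite setTI.
Qed.

Lemma measurable_survives k : measurable [set w | survives X k w].
Proof.
apply: measurable_exists => x.
apply: (measurable_infinite_cluster (B := occupied X k)).
exact: measurable_occupied.
Qed.

Lemma measurable_occupies_positive_density k :
  measurable [set w | occupies_positive_density X k w].
Proof.
apply: (measurable_positive_density R (B := occupied X k)).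
exact: measurable_occupied.
Qed.

Lemma fpphe_seed_field : seed_field p (seed X).
Proof.
split; first exact: fpphe_seed.
pose g (s : fpphe_source d) := if s is inl x then Some x else None.
have gK : pcancel inl g by [].
exact: (mutually_independent_pcan gK (@fpphe_independent _ _ _ _ _ _ _ X)).
Qed.

Lemma fpphe_clock1_independent :
  mutually_independent P (fun e => events_of (clock1 X e)).
Proof.
pose g (s : fpphe_source d) := if s is inr (inl e) then Some e else None.
have gK : pcancel (fun e => inr (inl e)) g by [].
exact: (mutually_independent_pcan gK (@fpphe_independent _ _ _ _ _ _ _ X)).
Qed.

Lemma fpphe_clock1_small e (eps : R) : 0 < eps ->
  (P [set w | (clock1 X e w <= eps)%R] <= eps%:E)%E.
Proof.
move=> eps0; apply: le_trans (exponential_prob_le eps0).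
rewrite -(fpphe_clock1 X e (measurable_itv _)) /distribution /pushforward.
by rewrite (_ : _ @^-1` _ = [set w | clock1 X e w <= eps]).
Qed.

Lemma fpphe_seed_density01 : (0 < d)%N -> 0 <= p <= 1.
Proof.
case: d X => // d' Y _.
have x0 : (const_mx 1 : site d'.+1) != 0.
  by apply/eqP => /rowP/(_ ord0); rewrite !mxE.
have := (fpphe_seed Y).2 _ x0; set A := [set w | _] => PA.
rewrite -!lee_fin -PA measure_ge0 probability_le1//.
exact: measurable_field_at.
Qed.

Lemma pc_filled_ge0 : 0 <= pc_filled R d.
Proof.
rewrite /pc_filled; set A := [set _ | _].
have [[q Aq]|nA] := pselect (A !=set0); last first.
  by rewrite (_ : A = set0) ?sup0//; apply/eqP/negPn/negP => /set0P.
have [/andP[q0 _] _] := Aq.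
by apply: le_trans q0 _; apply: ub_le_sup => //; exists 1 => r [/andP[]].
Qed.

(** Almost surely, once [FPP1] has a positive density it is not confined to a
    finite set, so that the filled seeds, which percolate, are all taken by the
    other process, as are in particular the seeds, which have positive density. *)
Lemma positive_density_coexist : (2 <= d)%N -> pc_filled R d < p ->
  0 < p ->
  {ae P, forall w, occupies_positive_density X FPP1 w ->
    [/\ coexist X w, occupies_positive_density X FPP1 w &
        occupies_positive_density X FPPlambda w]}.
Proof.
move=> d2 pcp p0; have d0 : (0 < d)%N by exact: leq_trans d2.
have p01 := fpphe_seed_density01 d0.
have percolates : {ae P, forall w, filled_percolates [set x | seed X x w]}.
  have mfp : measurable [set w | filled_percolates [set x | seed X x w]].
    apply: (measurable_filled_percolates (B := fun w => [set x | seed X x w])).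
    by move=> x; exact: measurable_field_at.
  exists (~` [set w | filled_percolates [set x | seed X x w]]); split=> //.
    exact: measurableC.
  have := filled_percolates_supercritical fpphe_seed_field p01 pcp.
  by rewrite probability_setC// => ->; rewrite subee.
(* There are [2 d] ways to continue a walk: the bound on the expected number of
   cheap walks is halved at each step. *)
pose eps : R := (d + d).*2%:R^-1.
have eps0 : 0 < eps by rewrite invr_gt0 ltr0n double_gt0 addn_gt0 d0.
have eps1 : eps *+ (d + d) < 1.
  by rewrite -mulr_natr mulrC ltr_pdivrMr ?mul1r ?ltr0n ?ltr_nat; lia.
have := seeds_positive_density fpphe_seed_field _ d2; rewrite p0 => /(_ (andP p01).2).
move: (no_long_cheap_walk fpphe_clock1_independent fpphe_clock1_small eps0 eps1).
move: (clocks_positive fpphe_clock1_small) percolates (fpphe_dynamics X).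
move=> tpos perc rules cheap dens.
apply: filterS3 (filterI tpos perc) (filterI rules cheap) dens.
move=> w [{}tpos {}perc] [{}rules {}cheap] dens pd1.
have seed0 := (fpphe_seed X).1 w.
have inf1 := positive_density_infinite d0 pd1.
have filledS := filled_occupied_by_lambda rules tpos eps0 cheap seed0 inf1.
split=> //; first split.
- exists 0; apply: sub_infinite_set inf1 => x [_ x1].
  exact: (FPP1_linked rules tpos eps0 cheap x1).
- have [z infz] := perc; exists z => fin; apply/infz/sub_finite_set/fin => y.
  exact: linkedS.
- apply: positive_densityS dens => x Sx; apply: filledS; left; exact: Sx.
Qed.

End occupied_events.

Unset Implicit Arguments.

Theorem corollary1p2 (R : realType) (d : nat) (hd : (3 <= d)%N)
    (p : R) (hp : pc_filled R d < p < 1 - pc_site R d)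
    (lambda_tilde : R) (hlambda_tilde : 0 < lambda_tilde)
    (hFPP1 : forall lambda : R, 0 < lambda < lambda_tilde ->
      forall (disp : measure_display) (T : measurableType disp)
             (P : probability T R) (X : fpphe d p lambda P),
        (0 < P [set w | occupies_positive_density X FPP1 w])%E)
    (lambda : R) (hlambda : 0 < lambda < lambda_tilde)
    (disp : measure_display) (T : measurableType disp) (P : probability T R)
    (X : fpphe d p lambda P) :
  (0 < P [set w | [/\ coexist X w,
                      occupies_positive_density X FPP1 w &
                      occupies_positive_density X FPPlambda w]])%E.
Proof.
move: hp => /andP[pcp _].
have p0 : 0 < p := le_lt_trans (pc_filled_ge0 R d) pcp.
apply: (ae_measure_gt0 _ _ (positive_density_coexist X (ltnW hd) pcp p0)).
- exact: measurable_occupies_positive_density.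
- apply: measurable_conj3; try exact: measurable_occupies_positive_density.
  by apply: measurable_conj; exact: measurable_survives.
- exact: hFPP1.
Qed.
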